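(* Let $n>2$, $N=\{1,\dots,n\}$, $a_k>0$ for all $k\in N$, $\beta=\sum_{k\in N}a_k$, $0<\ell<u<+\infty$, $0<p<q$, and let $i,j\in N$ be distinct. Let $f:\mathbb{R}^n_+\to\mathbb{R}_+$, $f(x)=\prod_{k\in N}x_k^{a_k}$, $X=\{x\in\mathbb{R}^n_+:\ell\le f(x)\le u\}$, $W_{ij}=\{x\in\mathbb{R}^n_+: p x_i\le x_j\le q x_i\}$, and let $z_0,\gamma$ be as defined in the context. If $\beta\ge 1$, then the upper envelope $E_U(f,X\cap W_{ij})$ of $f$ over $X\cap W_{ij}$ is the set of all $(x,z)\in\mathbb{R}^n_+\times\mathbb{R}$ such that $$z\le z_0+\Big(\gamma\prod_{k\in N}x_k^{a_k}\Big)^{1/\beta},\qquad z\le u,\qquad p x_i\le x_j\le q x_i,\qquad \prod_{k\in N}x_k^{a_k}\ge \ell .$$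
   Context: $\mathbb{R}_+$ denotes the nonnegative reals. For $T\subseteq\mathbb{R}^n$ and a real-valued function $f$ defined on $T$, the hypograph of $f$ in $T$ is $\mathrm{hyp}(f,T)=\{(x,z)\in T\times\mathbb{R}: z\le f(x)\}$, and the upper envelope $E_U(f,T)$ is the convex hull of $\mathrm{hyp}(f,T)$. Constants: $z_0=\dfrac{u^{1/\beta}\ell-\ell^{1/\beta}u}{u^{1/\beta}-\ell^{1/\beta}}$, $\gamma=\left(\dfrac{u-\ell}{u^{1/\beta}-\ell^{1/\beta}}\right)^{\beta}$. *)

(* Defs.v *)
From HB Require Import structures.
From mathcomp Require Import all_boot all_order all_algebra.
From mathcomp Require Import all_classical all_reals all_analysis.

Set Implicit Arguments.
Unset Strict Implicit.
Unset Printing Implicit Defensive.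

Import Order.TTheory GRing.Theory Num.Theory.
Local Open Scope classical_set_scope.
Local Open Scope ring_scope.

Definition convex_hull (R : realType) (M : lmodType R) (A : set M) : set M :=
  smallest (@convex_set R M) A.

Definition nonneg_orthant (R : realType) (n : nat) : set 'rV[R]_n :=
  [set x | forall k, 0 <= x 0 k].

(* [f] is a total function, but only its values on [T] matter.  The factor
   [R^o] is [R] seen as a module over itself, so that the product type is an
   [lmodType R], as convexity requires. *)
Definition hypograph (R : realType) (n : nat) (f : 'rV[R]_n -> R)
    (T : set 'rV[R]_n) : set ('rV[R]_n * R^o) :=
  [set xz | T xz.1 /\ xz.2 <= f xz.1].

Definition upper_envelope (R : realType) (n : nat) (f : 'rV[R]_n -> R)
    (T : set 'rV[R]_n) : set ('rV[R]_n * R^o) :=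
  convex_hull (hypograph f T).

(* Meant for [x] in the nonnegative orthant and positive exponents, where
   [powR] is the usual real power, with [0 `^ r = 0] for [r > 0]. *)
Definition monomial (R : realType) (n : nat) (a : 'I_n -> R)
    (x : 'rV[R]_n) : R :=
  \prod_(k < n) x 0 k `^ a k.

Definition level_region (R : realType) (n : nat) (f : 'rV[R]_n -> R)
    (l u : R) : set 'rV[R]_n :=
  [set x | nonneg_orthant x /\ l <= f x <= u].

Definition ratio_cone (R : realType) (n : nat) (i j : 'I_n) (p q : R) :
    set 'rV[R]_n :=
  [set x | nonneg_orthant x /\ p * x 0 i <= x 0 j <= q * x 0 i].

(* [z0_const] and [gamma_const] make [t |-> z0 + (gamma * t) `^ beta^-1] the
   affine function of [t `^ beta^-1] taking the values [l] at [t = l] and [u]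
   at [t = u]. *)
Definition z0_const (R : realType) (beta l u : R) : R :=
  (u `^ beta^-1 * l - l `^ beta^-1 * u) / (u `^ beta^-1 - l `^ beta^-1).

Definition gamma_const (R : realType) (beta l u : R) : R :=
  ((u - l) / (u `^ beta^-1 - l `^ beta^-1)) `^ beta.

(* Main.v *)
(* The function [g = f `^ beta^-1] is positively homogeneous and, by weighted
   AM-GM, concave, so the right-hand side is convex; it contains the hypograph
   because the convex power [t `^ beta] lies below its chord.  Conversely, let
   [(x, z)] satisfy the inequalities.  If [f x <= u], then [(x, z)] is a convex
   combination of two points of the hypograph over the ray through [x], at the
   levels [f = l] and [f = u].  If [f x > u], choose [k] different from [i] and
   [j] (this is where [2 < n] is used) and move along the line on which [x_k] is
   multiplied by [1 + t] and every other coordinate by [1 - t]: it stays in the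
   cone for [`|t| < 1], and [f], which tends to [0] at both ends, takes the
   value [u] on both sides of [x]. *)
Require Import Defs.
From HB Require Import structures.
From mathcomp Require Import all_boot all_order all_algebra.
From mathcomp Require Import all_classical all_reals all_analysis.
From mathcomp Require Import ring lra.

Import Order.TTheory GRing.Theory Num.Theory numFieldNormedType.Exports.
Local Open Scope classical_set_scope.
Local Open Scope ring_scope.

(** * Segments in convex sets and convex hulls *)

Lemma convex_hull_segment (R : realType) (M : lmodType R) (A : set M)
    (x y : M) (t : R) :
  A x -> A y -> 0 <= t <= 1 -> convex_hull A (t *: x + (1 - t) *: y).
Proof.
move=> Ax Ay /andP[t0 t1] B [Bcvx AB].
have := Bcvx x y (Itv01 t0 t1).
by rewrite !inE; apply; exact: AB.
Qed.

Lemma convex_set_segment (R : realType) (M : lmodType R) (A : set M) :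
  (forall x y t, A x -> A y -> 0 <= t <= 1 -> A (t *: x + (1 - t) *: y)) ->
  @convex_set R M A.
Proof.
move=> Aseg x y t; rewrite !inE => Ax Ay; apply: Aseg => //.
by rewrite ge0 le1.
Qed.

(** * Products of real powers: multiplicativity and homogeneity *)

Lemma prod_powR (R : realType) (I : finType) (F : I -> R) (r : R) :
  (forall k, 0 <= F k) -> (\prod_k F k) `^ r = \prod_k F k `^ r.
Proof.
(* Nonnegativity of the partial product is carried through the induction because [powRM] requires
   it. *)
move=> F0; suff [] : 0 <= \prod_k F k /\ (\prod_k F k) `^ r = \prod_k F k `^ r
  by [].
elim/big_rec2 : _ => [|k _ y _ [y0 <-]]; first by rewrite powR1.
by rewrite mulr_ge0// powRM.
Qed.

Lemma monomial_ge0 (R : realType) (n : nat) (a : 'I_n -> R) (x : 'rV[R]_n) :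
  0 <= monomial a x.
Proof. by apply: prodr_ge0 => k _; exact: powR_ge0. Qed.

Lemma monomial_gt0_coord (R : realType) (n : nat) (a : 'I_n -> R)
    (x : 'rV[R]_n) (k : 'I_n) :
  a k != 0 -> nonneg_orthant x -> 0 < monomial a x -> 0 < x 0 k.
Proof.
move=> ak0 x0 fx0; rewrite lt_def x0 andbT; apply/eqP => xk0.
by move: fx0; rewrite /monomial (bigD1 k)//= xk0 powR0// mul0r ltxx.
Qed.

(** Serves three kinds of scaling: uniform ones, the coordinate ratios in the concavity proof, and
    the distortion of a single coordinate against all others. *)
Lemma monomialM (R : realType) (n : nat) (a r : 'I_n -> R) (x : 'rV[R]_n) :
  (forall k, 0 <= r k) -> nonneg_orthant x ->
  monomial a (\row_k (r k * x 0 k)) = (\prod_k r k `^ a k) * monomial a x.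
Proof.
move=> r0 x0; rewrite /monomial -big_split/=; apply: eq_bigr => k _.
by rewrite mxE powRM.
Qed.

Lemma prod_powR_sum (R : realType) (I : finType) (P : pred I) (s : R)
    (a : I -> R) :
  0 < s -> \prod_(k | P k) s `^ a k = s `^ (\sum_(k | P k) a k).
Proof.
move=> s0; apply/esym; elim/big_rec2 : _ => [|k y z _ <-]; first exact: powRr0.
by rewrite powRD// (gt_eqF s0) implybT.
Qed.

Lemma monomialZ (R : realType) (n : nat) (a : 'I_n -> R) (s : R)
    (x : 'rV[R]_n) :
  0 < s -> nonneg_orthant x ->
  monomial a (s *: x) = s `^ (\sum_k a k) * monomial a x.
Proof.
move=> s0 x0; rewrite -prod_powR_sum// -monomialM//;
  last by move=> ?; exact: ltW.
by congr monomial; apply/rowP => k; rewrite !mxE.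
Qed.

Lemma monomial_powR (R : realType) (n : nat) (a : 'I_n -> R) (r : R)
    (x : 'rV[R]_n) :
  monomial a x `^ r = monomial (fun k => a k * r) x.
Proof.
rewrite /monomial prod_powR; last by move=> k; exact: powR_ge0.
by apply: eq_bigr => k _; rewrite powRrM.
Qed.

(** * Weighted AM-GM and concavity of monomials whose exponents sum to 1 *)

Lemma weighted_AGM (R : realType) (I : finType) (w r : I -> R) :
  (forall k, 0 <= w k) -> \sum_k w k = 1 -> (forall k, 0 < r k) ->
  \prod_k r k `^ w k <= \sum_k w k * r k.
Proof.
move=> w0 w1 r0; pose m := \sum_k w k * ln (r k).
have -> : \prod_k r k `^ w k = expR m.
  rewrite /m; elim/big_rec2 : _ => [|k y z _ ->]; first by rewrite expR0.
  by rewrite expRD /powR gt_eqF.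
(* Tangent line of [expR] at the weighted mean [m] of the logarithms. *)
have tangent k : expR m * (1 + (ln (r k) - m)) <= r k.
  have {2}-> : r k = expR m * expR (ln (r k) - m).
    by rewrite -expRD addrC subrK lnK// posrE.
  by rewrite ler_pM2l ?expR_gt0// expR_ge1Dx.
(* The tangent values average to exactly [expR m]: the weights sum to 1 and [m] is the mean of the
   logarithms, so the linear terms cancel. *)
suff -> : expR m = \sum_k w k * (expR m * (1 + (ln (r k) - m))).
  by apply: ler_sum => k _; rewrite ler_wpM2l.
have split_term k : w k * (expR m * (1 + (ln (r k) - m))) =
    w k * (expR m * (1 - m)) + w k * ln (r k) * expR m by ring.
rewrite (eq_bigr _ (fun k _ => split_term k)) big_split/= -!mulr_suml w1 -/m.
by ring.
Qed.

(** Let [z] be the combined point. AM-GM on the ratios [v 0 k / z 0 k] bounds the monomial at [v] by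
    its value at [z] times a factor linear in [v]; combining the factors of [x] and [y] gives the
    sum of the weights, 1. *)
Lemma monomial_concave (R : realType) (n : nat) (w : 'I_n -> R)
    (x y : 'rV[R]_n) (t : R) :
  (forall k, 0 <= w k) -> \sum_k w k = 1 ->
  (forall k, 0 < x 0 k) -> (forall k, 0 < y 0 k) -> 0 <= t <= 1 ->
  t * monomial w x + (1 - t) * monomial w y <=
  monomial w (t *: x + (1 - t) *: y).
Proof.
move=> w0 w1 x0 y0 /andP[t0 t1].
set z : 'rV[R]_n := t *: x + (1 - t) *: y.
have z0 k : 0 < z 0 k.
  rewrite !mxE; have [->|tn0] := eqVneq t 0.
    by rewrite mul0r add0r subr0 mul1r.
  by rewrite ltr_pwDl// ?mulr_gt0// ?mulr_ge0 ?subr_ge0// ?(ltW (y0 k))//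
    lt_def tn0.
have AGM (v : 'rV[R]_n) : (forall k, 0 < v 0 k) ->
    monomial w v <= (\sum_k w k * (v 0 k / z 0 k)) * monomial w z.
  move=> v0.
  have {1}-> : v = \row_k (v 0 k / z 0 k * z 0 k).
    by apply/rowP => k; rewrite mxE divfK// gt_eqF.
  rewrite monomialM; last 2 first.
  - by move=> k; rewrite divr_ge0// ltW.
  - by move=> k; rewrite ltW.
  rewrite ler_wpM2r ?monomial_ge0// weighted_AGM// => k.
  by rewrite divr_gt0.
apply: (@le_trans _ _ (t * ((\sum_k w k * (x 0 k / z 0 k)) * monomial w z) +
    (1 - t) * ((\sum_k w k * (y 0 k / z 0 k)) * monomial w z))).
  by rewrite lerD// ler_wpM2l ?AGM// subr_ge0.
rewrite !mulrA -mulrDl !mulr_sumr -big_split/=.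
set S := (X in X * _ <= _).
have -> : S = \sum_k w k; last by rewrite w1 mul1r.
apply: eq_bigr => k _.
transitivity (w k * ((t * x 0 k + (1 - t) * y 0 k) / z 0 k)); first by ring.
have -> : t * x 0 k + (1 - t) * y 0 k = z 0 k by rewrite !mxE.
by rewrite divff ?mulr1// gt_eqF.
Qed.

(** * The chord of the power [b], in terms of the [b]-th root *)

Lemma ltr_root (R : realType) (b l u : R) :
  0 < b -> 0 < l -> l < u -> l `^ b^-1 < u `^ b^-1.
Proof.
by move=> b0 l0 lu; rewrite gt0_ltr_powR ?invr_gt0// nnegrE ltW// (lt_trans l0).
Qed.

Lemma chord_l (R : realType) (b l u : R) : 0 < b -> 0 < l -> l < u ->
  z0_const b l u + (u - l) / (u `^ b^-1 - l `^ b^-1) * l `^ b^-1 = l.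
Proof.
move=> b0 l0 lu; rewrite /z0_const; field.
by rewrite subr_eq0 gt_eqF// ltr_root.
Qed.

Lemma chord_u (R : realType) (b l u : R) : 0 < b -> 0 < l -> l < u ->
  z0_const b l u + (u - l) / (u `^ b^-1 - l `^ b^-1) * u `^ b^-1 = u.
Proof.
move=> b0 l0 lu; rewrite /z0_const; field.
by rewrite subr_eq0 gt_eqF// ltr_root.
Qed.

(** [gamma_const] is the power [b] of the chord slope, so taking the root releases the slope as a
    factor and the bound becomes affine in the root of [s]. *)
Lemma gamma_root (R : realType) (b l u s : R) : 0 < b -> 0 < l -> l < u ->
  0 <= s -> (gamma_const b l u * s) `^ b^-1 =
  (u - l) / (u `^ b^-1 - l `^ b^-1) * s `^ b^-1.
Proof.
move=> b0 l0 lu s0; rewrite powRM ?powR_ge0//; congr (_ * _).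
rewrite /gamma_const -powRrM mulfV ?gt_eqF// powRr1//.
by rewrite divr_ge0 ?subr_ge0 ?ltW// ltr_root.
Qed.

Lemma itv_conv (R : realType) (A B S : R) : A < B -> A <= S <= B ->
  exists2 t : R, 0 <= t <= 1 & S = t * A + (1 - t) * B.
Proof.
move=> AB /andP[AS SB]; have BA0 : 0 < B - A by rewrite subr_gt0.
exists ((B - S) / (B - A)); last by field; rewrite gt_eqF.
apply/andP; split; first by rewrite divr_ge0// ?subr_ge0// ltW.
by rewrite ler_pdivrMr// mul1r lerD2l lerN2.
Qed.

Lemma affine_conv (R : realType) (z c t x y : R) :
  z + c * (t * x + (1 - t) * y) = t * (z + c * x) + (1 - t) * (z + c * y).
Proof. by ring. Qed.

Lemma powRVK (R : realType) (b s : R) : 0 < b -> 0 <= s -> (s `^ b^-1) `^ b = s.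
Proof. by move=> b0 s0; rewrite -powRrM mulVf ?gt_eqF// powRr1. Qed.

(** The root of [s] is a convex combination of the roots of [l] and [u]. The power [b] is convex
    since [1 <= b], so [s] is at most the same combination of [l] and [u], which is the chord
    value. *)
Lemma le_chord (R : realType) (b l u s : R) : 1 <= b -> 0 < l -> l < u ->
  l <= s <= u -> s <= z0_const b l u + (gamma_const b l u * s) `^ b^-1.
Proof.
move=> b1 l0 lu /andP[ls su]; have b0 : 0 < b by exact: lt_le_trans b1.
have u0 := lt_trans l0 lu; have s0 := lt_le_trans l0 ls.
rewrite gamma_root//; last exact: ltW.
have [t t01 sE] : exists2 t : R, 0 <= t <= 1 &
    s `^ b^-1 = t * l `^ b^-1 + (1 - t) * u `^ b^-1.
  apply: itv_conv; first exact: ltr_root.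
  by rewrite !ge0_ler_powR ?invr_ge0 ?nnegrE//; exact: ltW.
have t0 : 0 <= t by case/andP: t01.
have t1 : t <= 1 by case/andP: t01.
have : (t * l `^ b^-1 + (1 - t) * u `^ b^-1) `^ b <=
    t * (l `^ b^-1) `^ b + (1 - t) * (u `^ b^-1) `^ b.
  have := @convex_powR R b b1 (Itv01 t0 t1) (l `^ b^-1) (u `^ b^-1).
  by rewrite !inE/= !in_itv/= !andbT !powR_ge0 => /(_ isT isT).
rewrite -sE !powRVK ?(ltW l0) ?(ltW u0) ?(ltW s0)// => /le_trans; apply.
by rewrite sE affine_conv chord_l// chord_u.
Qed.

(** * Level crossing along a line, and scalings that preserve the ratio cone *)

Lemma two_factor_level (R : realType) (a b c : R) :
  0 < a -> 0 < b -> 0 < c < 1 ->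
  exists2 t : R, 0 < t < 1 & (1 + t) `^ a * (1 - t) `^ b = c.
Proof.
move=> a0 b0 /andP[c0 c1]; pose F t := (1 + t) `^ a * (1 - t) `^ b.
have F0 : F 0 = 1 by rewrite /F addr0 subr0 !powR1 mulr1.
have ta : 1 <= 2 `^ a :> R.
  by rewrite -[X in X <= _](powRr0 2) ler_powR ?ler1n// ltW.
have c2a : 0 < c / 2 `^ a by rewrite divr_gt0// (lt_le_trans ltr01).
(* [F] drops below [c] before reaching [1], where [powR ^~ b] need not be
   derivable. *)
pose d := (c / 2 `^ a) `^ b^-1.
have d0 : 0 < d by rewrite powR_gt0.
have d1 : d < 1.
  have pow1 : 1 `^ b^-1 = 1 :> R by rewrite powR1.
  rewrite -[ltRHS]pow1 gt0_ltr_powR ?invr_gt0 ?nnegrE ?ltW//.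
  by rewrite ltr_pdivrMr ?mul1r ?(lt_le_trans c1)// (lt_le_trans ltr01).
(* The power [b] of [d] is [c] divided by the power [a] of 2, and the other factor has base [2 - d],
   below 2. *)
have Fd : F (1 - d) <= c.
  have dE : 1 - (1 - d) = d by ring.
  rewrite /F dE /d powRVK ?(ltW c2a)//.
  rewrite mulrCA ger_pMr// ler_pdivrMr ?mul1r ?(lt_le_trans ltr01)//.
  rewrite -/d; apply: ge0_ler_powR; rewrite ?nnegrE ?(ltW a0)//;
    by move: (d) d0 d1 => e; lra.
have Fcont : {within `[0, 1 - d], continuous F}.
  apply: derivable_within_continuous => t; rewrite in_itv/= => /andP[t0 t1].
  have t10 : 0 < 1 + t by lra.
  have t20 : 0 < 1 - t by lra.
  have powR_derivable (g : R -> R) e dg : is_derive t 1 g dg -> 0 < g t ->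
      derivable (fun s => g s `^ e) t 1.
    move=> dgt gt0; have D := is_derive1_comp (is_derive1_powR e gt0) dgt.
    exact: (@ex_derive _ _ _ _ _ _ _ D).
  by apply: derivableM; [exact: powR_derivable t10|exact: powR_derivable t20].
have [||t tin Ft] := @IVT R F 0 (1 - d) c _ Fcont.
- by rewrite subr_ge0 ltW.
- by rewrite F0 ge_min le_max Fd orbT (ltW c1).
exists t => //; move: tin; rewrite in_itv/= => /andP[t0 t1].
rewrite lt_def t0 andbT; apply/andP; split; last lra.
by apply/eqP => tE; move: Ft c1; rewrite tE F0 => ->; rewrite ltxx.
Qed.

Lemma monomial_two_factors (R : realType) (n : nat) (a : 'I_n -> R) (k : 'I_n)
    (s s' : R) (x : 'rV[R]_n) :
  0 < s -> 0 < s' -> nonneg_orthant x ->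
  monomial a (\row_m ((if m == k then s else s') * x 0 m)) =
  s `^ a k * s' `^ (\sum_(m | m != k) a m) * monomial a x.
Proof.
move=> s0 s'0 x0; rewrite monomialM//; last first.
  by move=> m; case: ifP => _; exact: ltW.
congr (_ * _); rewrite (bigD1 k)//= eqxx -prod_powR_sum//; congr (_ * _).
by apply: eq_bigr => m /negbTE ->.
Qed.

(** The cone constrains only the coordinates [i] and [j], so a common factor on these two suffices.
    This covers both the rays and the line that distorts a third coordinate. *)
Lemma ratio_coneM (R : realType) (n : nat) (i j : 'I_n) (p q : R)
    (r : 'I_n -> R) (x : 'rV[R]_n) :
  (forall m, 0 <= r m) -> r i = r j -> ratio_cone i j p q x ->
  ratio_cone i j p q (\row_m (r m * x 0 m)).
Proof.
move=> r0 rij [x0 /andP[px qx]]; split=> [m|]; first by rewrite mxE mulr_ge0.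
by rewrite !mxE rij !(mulrCA _ (r j)) !ler_wpM2l.
Qed.

(** * The two inclusions between the envelope and the set of inequalities *)

Theorem proposition3 (R : realType) (n : nat) (a : 'I_n -> R)
    (l u p q : R) (i j : 'I_n)
    (n_gt2 : (2 < n)%N)
    (a_gt0 : forall k : 'I_n, 0 < a k)
    (l_gt0 : 0 < l) (l_lt_u : l < u)
    (p_gt0 : 0 < p) (p_lt_q : p < q)
    (i_neq_j : i <> j) :
  let beta := \sum_(k < n) a k in
  let f := monomial a in
  let X := level_region f l u in
  let W := ratio_cone i j p q in
  let z0 := z0_const beta l u in
  let gamma := gamma_const beta l u in
  1 <= beta ->
  upper_envelope f (X `&` W) =
  [set xz : 'rV[R]_n * R^o |
    [/\ nonneg_orthant xz.1,
        xz.2 <= z0 + (gamma * \prod_(k < n) xz.1 0 k `^ a k) `^ beta^-1,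
        xz.2 <= u,
        p * xz.1 0 i <= xz.1 0 j <= q * xz.1 0 i &
        l <= \prod_(k < n) xz.1 0 k `^ a k]].
Proof.
move=> beta f X W z0 gamma beta1.
have beta0 : 0 < beta by exact: lt_le_trans beta1.
have u_gt0 := lt_trans l_gt0 l_lt_u.
(* The slope of the chord; its sign lets concavity of the root of [f] pass to the upper bound. *)
pose c := (u - l) / (u `^ beta^-1 - l `^ beta^-1).
have c0 : 0 <= c by rewrite divr_ge0 ?subr_ge0 ?ltW// ltr_root.
have f0 x : 0 <= f x by exact: monomial_ge0.
have rootE (x : 'rV[R]_n) :
    (gamma * \prod_(k < n) x 0 k `^ a k) `^ beta^-1 = c * f x `^ beta^-1.
  by apply: gamma_root => //; exact: f0.
(* The positive level [l] keeps points off the boundary of the orthant, as the concavity lemma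
   demands. *)
have coord0 x k : nonneg_orthant x -> l <= f x -> 0 < x 0 k.
  move=> x0 lf; apply: (@monomial_gt0_coord _ _ a) => //.
    by rewrite gt_eqF.
  exact: lt_le_trans lf.
(* The root of [f] is a monomial with exponents [a k / beta], which sum to 1. *)
have g_concave (x y : 'rV[R]_n) t : (forall k, 0 < x 0 k) ->
    (forall k, 0 < y 0 k) -> 0 <= t <= 1 ->
    t * f x `^ beta^-1 + (1 - t) * f y `^ beta^-1 <=
    f (t *: x + (1 - t) *: y) `^ beta^-1.
  move=> x0 y0 t01; rewrite /f !monomial_powR; apply: monomial_concave => //.
    by move=> k; rewrite divr_ge0 ?ltW.
  by rewrite -mulr_suml mulfV// gt_eqF.
apply/seteqP; split.
  apply: smallest_sub; last first.
    move=> [x z] /= [[[x0 /andP[lf fu]] [_ Wx]] zf]; split => //.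
      by apply: le_trans zf _; apply: le_chord => //; rewrite lf.
    exact: le_trans fu.
  apply: convex_set_segment => -[x z] [y z'] t.
  move=> [/= x0 xz xu /andP[xp xq] xl] [/= y0 yz yu /andP[yp yq] yl] t01.
  have /andP[t0 t1] := t01; rewrite -subr_ge0 in t1.
  rewrite !rootE in xz yz.
  have conv_mono (A B A' B' : R) : A <= A' -> B <= B' ->
      t * A + (1 - t) * B <= t * A' + (1 - t) * B'.
    by move=> AA BB; rewrite lerD// ler_wpM2l.
  have convE (A : R) : t * A + (1 - t) * A = A by ring.
  have gv := g_concave x y t (fun k => coord0 x k x0 xl)
    (fun k => coord0 y k y0 yl) t01.
  have f_ge s : l <= s -> l `^ beta^-1 <= s `^ beta^-1.
    move=> ls; have s0 := le_trans (ltW l_gt0) ls.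
    by rewrite ge0_ler_powR ?invr_ge0 ?nnegrE//; exact: ltW.
  split.
  - by move=> k; rewrite !mxE addr_ge0// mulr_ge0.
  - rewrite rootE; apply: le_trans (conv_mono _ _ _ _ xz yz) _.
    by rewrite -affine_conv lerD2l ler_wpM2l.
  - by rewrite -[leRHS]convE conv_mono.
  - rewrite !mxE !mulrDr !(mulrCA _ t) !(mulrCA _ (1 - t)).
    by rewrite !conv_mono.
  (* Concavity is available for the root of [f], so the roots are compared first and then raised to
     the power [beta]. *)
  - suff : (l `^ beta^-1) `^ beta <=
        (f (t *: x + (1 - t) *: y) `^ beta^-1) `^ beta.
      by rewrite !powRVK ?f0 ?(ltW l_gt0).
    apply: ge0_ler_powR; rewrite ?nnegrE ?powR_ge0 ?(ltW beta0)//.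
    by apply: le_trans gv; rewrite -[leLHS]convE conv_mono ?f_ge.
move=> [x z] /= [x0 xz xu Wx lf].
rewrite rootE in xz.
have [fu|uf] := leP (f x) u.
  pose g := f x `^ beta^-1.
  have g0 : 0 < g by rewrite powR_gt0// (lt_le_trans l_gt0).
  have fxE : g `^ beta = f x by exact: powRVK.
  have [t t01 gE] : exists2 t : R, 0 <= t <= 1 &
      g = t * l `^ beta^-1 + (1 - t) * u `^ beta^-1.
    apply: itv_conv; first exact: ltr_root.
    by rewrite /g !ge0_ler_powR ?invr_ge0 ?nnegrE//; exact: ltW.
  (* Since [f] is homogeneous of degree [beta], this factor brings the point to level [s]. *)
  pose ray s : 'rV[R]_n := (s `^ beta^-1 / g) *: x.
  have rayP s d : l <= s <= u -> 0 <= d ->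
      hypograph f (X `&` W) (ray s, s - d).
    move=> /andP[ls su] d0; have s0 := lt_le_trans l_gt0 ls.
    have r0 : 0 < s `^ beta^-1 / g by rewrite divr_gt0// powR_gt0.
    have fray : f (ray s) = s.
      rewrite /f monomialZ// -/beta -[monomial a x]/(f x) -fxE.
      rewrite -powRM ?(ltW r0) ?(ltW g0)// divfK ?gt_eqF//.
      by rewrite powRVK ?(ltW s0).
    have W_ray : ratio_cone i j p q (ray s).
      have := @ratio_coneM _ _ i j p q (fun=> s `^ beta^-1 / g) x.
      rewrite (_ : \row_m _ = ray s); last by apply/rowP => m; rewrite !mxE.
      by apply => //; move=> _; exact: ltW.
    split; last by rewrite fray gerBl.
    by split=> //; split; [case: W_ray|rewrite fray ls].
  (* The vertical gap between [z] and its bound; lowering both end points by [d] makes their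
     combination hit [z]. *)
  pose d := z0 + c * g - z.
  have d0 : 0 <= d by rewrite subr_ge0.
  rewrite [(x, z)](_ : _ = t *: (ray l, l - d) + (1 - t) *: (ray u, u - d)).
    apply: convex_hull_segment => //; apply: rayP => //.
      by rewrite lexx ltW.
    by rewrite lexx ltW.
  apply: injective_projections => /=.
    rewrite /ray !scalerA -scalerDl !mulrA -mulrDl -gE divff ?scale1r//.
    by rewrite gt_eqF.
  transitivity (t * (l - d) + (1 - t) * (u - d)); last by [].
  have chord : z0 + c * g = t * l + (1 - t) * u.
    by rewrite gE affine_conv chord_l// chord_u.
  by rewrite /d chord; ring.
have [k /andP[ki kj]] : exists k, (k != i) && (k != j).
  have /card_gt0P[k] : (0 < #|~: [set i; j]%SET|)%N.
    rewrite -(ltn_add2l #|[set i; j]%SET|) addn0 cardsC card_ord cards2.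
    by apply: leq_ltn_trans n_gt2; case: (i != j).
  by rewrite !inE negb_or; exists k.
pose b := \sum_(m | m != k) a m.
have b0 : 0 < b.
  rewrite /b (bigD1 i)/=; last by rewrite eq_sym.
  by rewrite ltr_pwDl// sumr_ge0// => m _; exact: ltW.
have uf01 : 0 < u / f x < 1.
  have fx0 := lt_trans u_gt0 uf.
  by rewrite divr_gt0//= ltr_pdivrMr// mul1r.
have [t1 /andP[t1_gt0 t1_lt1] t1E] :=
  two_factor_level _ _ _ _ (a_gt0 k) b0 uf01.
(* Exchanging the exponents gives the crossing on the other side of [x]: the coordinate [k] shrinks
   by [1 - t2] and the others grow by [1 + t2]. *)
have [t2 /andP[t2_gt0 t2_lt1] t2E] :=
  two_factor_level _ _ _ _ b0 (a_gt0 k) uf01.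
pose P s s' : 'rV[R]_n := \row_m ((if m == k then s else s') * x 0 m).
have PP s s' : 0 < s -> 0 < s' -> s `^ a k * s' `^ b = u / f x ->
    hypograph f (X `&` W) (P s s', z).
  move=> s0 s'0 sE.
  have fP : f (P s s') = u.
    rewrite /f monomial_two_factors// -/b sE divfK//.
    by rewrite gt_eqF// (lt_trans u_gt0 uf).
  have WP : ratio_cone i j p q (P s s').
    apply: ratio_coneM => //;
      last by rewrite !(eq_sym _ k) (negbTE ki) (negbTE kj).
    by move=> m; case: ifP => _; exact: ltW.
  split; last by rewrite fP.
  by split=> //; split; [case: WP|rewrite fP lexx ltW].
have t12 : 0 < t1 + t2 by rewrite addr_gt0.
(* The crossings lie at parameters [t1] and [- t2]; these weights average them to 0, the parameter
   of [x]. *)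
rewrite [(x, z)](_ : _ = (t2 / (t1 + t2)) *: (P (1 + t1) (1 - t1), z) +
    (1 - t2 / (t1 + t2)) *: (P (1 - t2) (1 + t2), z)).
  apply: convex_hull_segment.
  - by apply: PP => //; rewrite ?subr_gt0// addr_gt0.
  - by apply: PP; rewrite ?subr_gt0// ?addr_gt0// mulrC.
  - by rewrite divr_ge0 ?(ltW t2_gt0) ?(ltW t12)//= ler_pdivrMr//
      mul1r lerDr ltW.
apply: injective_projections => /=; last first.
  transitivity (t2 / (t1 + t2) * z + (1 - t2 / (t1 + t2)) * z); last by [].
  by ring.
apply/rowP => m; rewrite !mxE; case: ifP => _; field; by rewrite gt_eqF.
Qed.
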